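(* Let $G$ be a Hausdorff topological group. Then $G$ is tame if and only if $G$ is precompact.
   Context: All function spaces and Banach spaces are over $\mathbb{R}$. Let $G$ be a topological group with identity $e$. A bounded continuous function $f:G\to\mathbb{R}$ is right uniformly continuous if for every $\varepsilon>0$ there is a neighborhood $U$ of $e$ such that $|f(g)-f(h)|<\varepsilon$ whenever $gh^{-1}\in U$. The set of all such functions, with the supremum norm $\|\cdot\|_\infty$, is denoted $\mathrm{RUC}(G)$. For $f\in\mathrm{RUC}(G)$ and $g\in G$ define $f\cdot g\in \mathrm{RUC}(G)$ by $(f\cdot g)(h)=f(gh)$ for $h\in G$; the orbit of $f$ is $fG=\{f\cdot g: g\in G\}$. A sequence $(f_n)_{n\in\mathbb{N}}$ of bounded real-valued functions on a set is equivalent to the standard basis of $\ell_1$ (is an $\ell_1$-sequence) if there are constants $a,b>0$ such that $a\sum_{k=1}^n|c_k|\le\left\|\sum_{k=1}^n c_kf_k\right\|_\infty\le b\sum_{k=1}^n|c_k|$ for all $n\in\mathbb{N}$ and all $c_1,\dots,c_n\in\mathbb{R}$. A function $f\in\mathrm{RUC}(G)$ is tame if its orbit $fG$ does not contain a sequence equivalent to the standard basis of $\ell_1$. The group $G$ is tame if every $f\in\mathrm{RUC}(G)$ is tame. The group $G$ is precompact if for every open neighborhood $U$ of $e$ there is a finite set $F\subseteq G$ with $G=UF$ (equivalently, one may require $G=FU$). *)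

(* Defs.v *)
From HB Require Import structures.
From mathcomp Require Import all_boot all_order all_algebra.
From mathcomp Require Import all_classical all_reals all_analysis.

Set Implicit Arguments.
Unset Strict Implicit.
Unset Printing Implicit Defensive.

Import Order.TTheory GRing.Theory Num.Theory.
Import numFieldNormedType.Exports.

Local Open Scope classical_set_scope.
Local Open Scope ring_scope.

(* MathComp-Analysis only has additive, hence abelian, topological groups
   (topologicalZmodType); this is the multiplicative, possibly noncommutative
   version. No separation axiom is included. *)
HB.structure Definition PreTopologicalGroup :=
  {G of Topological G & Group G}.

HB.mixin Record PreTopologicalGroup_isTopologicalGroup G
    & PreTopologicalGroup G := {
  mulg_continuous : continuous (fun xy : G * G => (xy.1 * xy.2)%g) ;
  invg_continuous : continuous (fun x : G => (x^-1)%g)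
}.

#[short(type="topologicalGroupType")]
HB.structure Definition TopologicalGroup :=
  {G of PreTopologicalGroup G & PreTopologicalGroup_isTopologicalGroup G}.

Section TameGroups.
Context {R : realType}.

(* As sup is 0 on sets that have no supremum, this is the supremum norm only
   for bounded functions. *)
Definition supnorm {T : Type} (f : T -> R) : R :=
  sup (range (fun x => `|f x|)).

Definition l1_sequence {T : Type} (u : nat -> T -> R) : Prop :=
  (forall n, bounded_fun (u n)) /\
  exists a b : R, [/\ 0 < a, 0 < b &
    forall (n : nat) (c : 'I_n -> R),
      a * (\sum_(k < n) `|c k|) <= supnorm (fun x => \sum_(k < n) c k * u k x)
        <= b * (\sum_(k < n) `|c k|)].

Context {G : topologicalGroupType}.

(* The right uniformity of G: g and h are close when g h^-1 is close to 1. *)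
Definition RUC : set (G -> R) :=
  [set f | [/\ bounded_fun f, continuous f &
    forall eps : R, 0 < eps ->
      exists2 U : set G, nbhs (1%g : G) U &
        forall g h : G, U (g * h^-1)%g -> `|f g - f h| < eps]].

Definition RUC_act (f : G -> R) (g : G) : G -> R := fun h => f (g * h)%g.

Definition RUC_orbit (f : G -> R) : set (G -> R) := range (RUC_act f).

Definition tame_function (f : G -> R) : Prop :=
  ~ exists u : nat -> G -> R,
      (forall n, RUC_orbit f (u n)) /\ l1_sequence u.

End TameGroups.

Arguments RUC R G : clear implicits.

Definition tame_group (R : realType) (G : topologicalGroupType) : Prop :=
  forall f : G -> R, RUC R G f -> tame_function f.

(* This is not the library's precompact, which means that the closure is
   compact. *)
Definition precompact_group (G : topologicalGroupType) : Prop :=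
  forall U : set G, open U -> U 1%g ->
    exists2 F : set G, finite_set F &
      [set: G] = [set (u * x)%g | u in U & x in F].

(* Main.v *)
Require Import Defs.
From mathcomp Require Import all_boot all_order all_algebra.
From mathcomp Require Import all_classical all_reals all_analysis.

Import Order.TTheory GRing.Theory Num.Theory.
Import numFieldNormedType.Exports.

Local Open Scope classical_set_scope.
Local Open Scope ring_scope.

(** If G is precompact and f is in RUC(G), then the orbit of f is totally
    bounded for the supremum norm, because g h^-1 close to 1 forces f.g and f.h
    to be uniformly close. Any sequence in the orbit then has two terms that are
    arbitrarily close, while distinct terms of an l1-sequence stay at distance
    at least 2a ([precompact_tame]).

    Conversely let U be an open neighborhood of 1 such that no finite union of
    translates U x is G, and let V be a small symmetric neighborhood of 1. The
    key fact is that even a finite union of two-sided translates a V b cannot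
    be G ([two_sided_escape]). Since a V b = (a V a^-1) a b, this concerns covers
    by right translates of finitely many conjugates of V, and it is the analogue
    for neighborhoods of Neumann's lemma on covers of a group by cosets of
    subgroups ([cover_member_syndetic]).

    It allows a recursive choice of points g_n of G and, for each finite 0-1
    pattern s, of a point h_s, such that the points g_n h_s with n < size s are
    pairwise V-separated ([scattered_sequences]). Let S be the set of those
    g_n h_s for which the n-th bit of s is 0. A Birkhoff-Kakutani distance to S
    gives f in RUC(G) that is 0 on S and 1 outside V S ([RUC_separation]), so the
    translate of f by g_n takes at h_s the value of the n-th bit of s. The
    translates thus realise all finite 0-1 patterns, and such a sequence is
    equivalent to the basis of l1 ([independent_l1_sequence]). *)

(** * Recursive choice *)

Lemma dependent_sequence {T : Type} (P : seq T -> T -> Prop) :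
  (forall l, exists x, P l x) -> exists u : nat -> T, forall n, P (mkseq u n) (u n).
Proof.
move=> /choice[c cP].
pose hist := fix hist n := if n is m.+1 then rcons (hist m) (c (hist m)) else [::].
exists (c \o hist) => n /=.
suff -> : mkseq (c \o hist) n = hist n by exact: cP.
by elim: n => //= n IH; rewrite mkseqS IH.
Qed.

(** * Covering a group by two-sided translates *)

(** Neumann's argument, by induction on the number of sets. If finitely many
    translates of V_i^-1 V_i do not cover G, then some translate V_i x0 is
    disjoint from the translates of V_i in the given cover. It is then covered
    by translates of the other sets, hence so is every translate of V_i, and
    V_i can be dropped from the cover. *)
Lemma cover_member_syndetic {G : topologicalGroupType} {I : eqType}
    (V : I -> set G) (r : seq I) (F : I -> seq G) :
  (forall x, exists2 i, i \in r & exists2 y, y \in F i & V i (x / y)%g) ->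
  exists2 i, i \in r & exists t : seq G, forall x,
    exists2 y, y \in t & exists v w, [/\ V i v, V i w & (x / y = v^-1 * w)%g].
Proof.
elim: r F => [|i r IH] F cov; first by have [] := cov 1%g.
have [[t tP]|/forallNP/(_ (F i))/existsNP[x0 x0P]] := pselect (exists t : seq G,
    forall x, exists2 y, y \in t & exists v w, [/\ V i v, V i w & (x / y = v^-1 * w)%g]).
  by exists i; [rewrite mem_head | exists t].
have cov0 v : V i v ->
    exists2 j, j \in r & exists2 y, y \in F j & V j (v * x0 / y)%g.
  move=> Vv; have [j] := cov (v * x0)%g.
  rewrite inE => /predU1P[->{j}|jr] [y yF Vy]; last by exists j => //; exists y.
  case: x0P; exists y => //; exists v, (v * x0 / y)%g; split=> //.
  by rewrite -mulgA mulKg.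
(* If V_i z contains x, then V_i x0 contains x z^-1 x0; a translate V_j y
   containing the latter yields the translate V_j (y x0^-1 z) containing x. *)
pose F' j := F j ++ [seq (y / x0 * z)%g | y <- F j, z <- F i].
have [|j jr jP] := IH F'; last by exists j; [rewrite inE jr orbT|].
move=> x; have [j] := cov x; rewrite inE => /predU1P[->{j}|jr] [z zF Vz].
  have [j jr [y yF Vy]] := cov0 _ Vz.
  exists j => //; exists (y / x0 * z)%g.
    by rewrite mem_cat; apply/orP; right; apply/allpairsP; exists (y, z).
  by rewrite !invgM invgK !mulgA in Vy *.
by exists j => //; exists z => //; rewrite mem_cat zF.
Qed.

(** If the sets a^-1 V b^-1 covered G, then so would right translates of
    finitely many conjugates of V. By [cover_member_syndetic], finitely many right
    translates of a conjugate of V^-1 V, hence of U, would cover G, and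
    conjugating back gives finitely many right translates of U. *)
Lemma two_sided_escape {G : topologicalGroupType} (U V : set G) :
  ~ (exists2 F : set G, finite_set F & [set: G] = [set (u * x)%g | u in U & x in F]) ->
  (forall v w, V v -> V w -> U (v^-1 * w)%g) ->
  forall s : seq (G * G), exists x, forall p, p \in s -> ~ V (p.1 * x * p.2)%g.
Proof.
move=> Ubig VU s; apply: contrapT => /forallNP covs; apply: Ubig.
pose W (a : G) := [set x | V (a * x / a)%g].
pose F (a : G) := [seq (p.2 * a)^-1%g | p <- s & p.1 == a].
have [x|a _ [t tP]] := @cover_member_syndetic G G W (map fst s) F.
  have /existsNP[p /not_implyP[ps /contrapT Vp]] := covs x.
  exists p.1; first exact: map_f.
  exists (p.2 * p.1)^-1%g; last by rewrite /W /= invgK !mulgA mulgK.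
  by apply: (map_f (fun p => (p.2 * _)^-1%g)); rewrite mem_filter eqxx.
exists [set (a * y)%g | y in [set` t]]; first exact/finite_image/finite_seqP/(ex_intro _ t).
apply/seteqP; split=> // x _.
have [y yt [v [w [Vv Vw e]]]] := tP (a^-1 * x)%g.
exists ((a * v / a)^-1 * (a * w / a))%g; first exact: VU.
exists (a * y)%g; first by exists y.
have -> : x = (a * (a^-1 * x / y) * y)%g by rewrite !mulgA mulgV mul1g mulgVK.
by rewrite e !invgM invgK !mulgA !mulgVK.
Qed.

(** * Separating functions *)

Lemma sub_cube_nbhs {G : topologicalGroupType} (U : set G) : nbhs 1%g U ->
  exists V : set G, [/\ nbhs 1%g V, forall x, V x -> V x^-1%g
    & forall x y z, V x -> V y -> V z -> U (x * y * z)%g].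
Proof.
have square (A : set G) : nbhs 1%g A ->
    exists2 B : set G, nbhs 1%g B & forall x y, B x -> B y -> A (x * y)%g.
  move=> A1; have := @mulg_continuous G (1, 1)%g A.
  rewrite /= mulg1 => /(_ A1)[[B C] /= [B1 C1] BC].
  exists (B `&` C); first exact: filterI.
  by move=> x y [Bx _] [_ Cy]; exact: (BC (x, y)).
move=> /square[A A1 AU]; have [B B1 BA] := square _ A1.
have D1 : nbhs (1%g : G) (A `&` B) by exact: filterI.
exists ((A `&` B) `&` [set x | (A `&` B) x^-1%g]); split.
- apply: filterI => //.
  by have := @invg_continuous G 1%g (A `&` B); rewrite /= invg1; exact.
- by move=> x [] /= ? ?; split=> //=; rewrite invgK.
- by move=> x y z [[_ Bx] _] [[_ By] _] [[Az _] _]; apply: AU => //; exact: BA.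
Qed.

Lemma bounded_fun_le {R : realType} {T : Type} (f : T -> R) (M : R) :
  (forall x, `|f x| <= M) -> bounded_fun f.
Proof.
move=> fM; exists M; split=> [|N MN x _]; first exact: num_real.
exact: le_trans (fM x) (ltW MN).
Qed.

Lemma right_uniform_continuous {R : realType} {G : topologicalGroupType} (f : G -> R) :
  (forall eps : R, 0 < eps -> exists2 U : set G, nbhs 1%g U &
    forall g h : G, U (g / h)%g -> `|f g - f h| < eps) -> continuous f.
Proof.
move=> fu x; apply/cvgrPdist_lt => e /fu[U U1 Uf].
have xx : (fun y : G => (x / y)%g) @ x --> (x / x)%g.
  apply: (@continuous2_cvg _ _ _ _ _ _ (fun _ => x) (fun y : G => y^-1%g)
    (fun a b : G => (a * b)%g)).
  - exact: (@mulg_continuous G (x, x^-1)%g).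
  - exact: cvg_cst.
  - exact: (@invg_continuous G x).
rewrite mulgV in xx.
have xU : nbhs x [set y | U (x / y)%g] := xx U U1.
by apply: filterS xU => y; exact: Uf.
Qed.

(** A list of exponents l = [:: n_1; ...; n_k] stands for the product
    W_(n_1) ... W_(n_k); its weight is the length that a path with such steps
    has in the Birkhoff-Kakutani construction. *)
Definition weight {R : realType} (l : seq nat) : R := \sum_(n <- l) 2 ^- n.

Lemma weight_cons {R : realType} n l : weight (n :: l) = 2 ^- n + weight l :> R.
Proof. by rewrite /weight big_cons. Qed.

Lemma weight_ge0 {R : realType} l : 0 <= weight l :> R.
Proof. by apply: sumr_ge0 => n _; rewrite invr_ge0 exprn_ge0. Qed.

Lemma weight_cat {R : realType} l m : weight (l ++ m) = weight l + weight m :> R.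
Proof. by rewrite /weight big_cat. Qed.

(** The step k is the one at which the remaining weight first drops below d. *)
Lemma weight_split {R : realType} (l : seq nat) (c d : R) :
  l != [::] -> 0 < c -> 0 < d -> weight l < c + d ->
  exists l1 k l2, [/\ l = l1 ++ k :: l2, weight l1 < c & weight l2 < d].
Proof.
elim: l c => // a l IH c _ c0 d0; rewrite weight_cons => lt_cd.
have [ld|dl] := ltP (weight l) d.
  by exists [::], a, l; split; rewrite // /weight big_nil.
have l0 : l != [::] by apply: contraTneq dl => ->; rewrite /weight big_nil -ltNge.
have [||l1 [k [l2 [-> l1c l2d]]]] := IH (c - 2 ^- a) l0 _ d0.
- by rewrite subr_gt0 -(ltrD2r d); apply: le_lt_trans lt_cd; rewrite lerD2l.
- by rewrite addrAC ltrBrDl.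
exists (a :: l1), k, l2; split=> //.
by rewrite weight_cons -ltrBrDl.
Qed.

Section Chains.
Context {R : realType} {G : topologicalGroupType} (W : nat -> set G).
Hypothesis W1 : forall n, nbhs 1%g (W n).
Hypothesis WV : forall n x, W n x -> W n x^-1%g.
Hypothesis W3 : forall n x y z, W n.+1 x -> W n.+1 y -> W n.+1 z -> W n (x * y * z)%g.

Fixpoint chain (l : seq nat) : set G :=
  if l is n :: l' then [set (x * y)%g | x in W n & y in chain l'] else [set 1%g].

Lemma chain_cat l m x : chain (l ++ m) x ->
  exists y z, [/\ chain l y, chain m z & x = (y * z)%g].
Proof.
elim: l x => [|n l IH] x /=; first by exists 1%g, x; rewrite mul1g.
move=> [u Wu [v /IH[y [z [ly mz ->]]] <-]].
by exists (u * y)%g, z; rewrite mulgA; split=> //; exists u => //; exists y.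
Qed.

Lemma decreasing_cubes m n : (m <= n)%N -> W n `<=` W m.
Proof.
elim: n => [|n IH]; first by rewrite leqn0 => /eqP ->.
rewrite leq_eqVlt => /predU1P[->//|/IH] nm x Wx; apply: nm.
have W11 : W n.+1 1%g by exact: nbhs_singleton.
by have := W3 n _ _ _ Wx W11 W11; rewrite !mulg1.
Qed.

(** The heart of the Birkhoff-Kakutani construction. A list of weight less than
    2^-n splits around one step j into two lists of weight less than 2^-(n+1).
    The step satisfies n < j, since its own weight is less than 2^-n, so by
    induction all three parts lie in W_(n+1). *)
Lemma light_chain n l x : weight l < 2 ^- n :> R -> chain l x -> W n x.
Proof.
have [k] := ubnP (size l); elim: k n l x => // k IH n l x.
have [->|l0] := eqVneq l [::].
  by move=> _ _ /= ->; exact: nbhs_singleton.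
rewrite ltnS => lk lt_ln; have h0 m : 0 < 2 ^- m :> R by rewrite invr_gt0 exprn_gt0.
have [|l1 [j [l2 [le l1n l2n]]]] := weight_split l (2 ^- n.+1) _ l0 (h0 n.+1) (h0 n.+1).
  by rewrite exprS invfM [2^-1 * _]mulrC -splitr.
have jn : (n < j)%N.
  rewrite ltnNge; apply: contraTN lt_ln => jn; rewrite -leNgt le weight_cat weight_cons.
  apply: (@le_trans _ _ (2 ^- j)).
    by rewrite lef_pV2 ?posrE ?exprn_gt0// ler_eXn2l ?ltr1n.
  by rewrite addrCA lerDl addr_ge0 ?weight_ge0.
move: lk; rewrite le size_cat /= addnS => lk.
move=> /chain_cat[y [z [l1y [u Wu [v l2v <-]] ->]]]; rewrite mulgA.
apply: W3; [apply: (IH _ l1) => //|exact: decreasing_cubes Wu|apply: (IH _ l2) => //].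
- by apply: leq_ltn_trans lk; exact: leq_addr.
- by apply: leq_ltn_trans lk; exact: leq_addl.
Qed.

(** The value 1 is included so that [chain_dist] is the infimum of a nonempty
    set and is truncated at 1. *)
Definition chain_weights (S : set G) (x : G) : set R :=
  [set r | r = 1 \/ exists2 s, S s & exists2 l, chain l (x / s)%g & r = weight l].

Definition chain_dist (S : set G) (x : G) : R := inf (chain_weights S x).

Lemma chain_weights_has_inf S x : has_inf (chain_weights S x).
Proof.
split; first by exists 1; left.
by exists 0 => _ [->|[s _ [l _ ->]]]; [exact: ler01|exact: weight_ge0].
Qed.

Lemma chain_dist_le S x r : chain_weights S x r -> chain_dist S x <= r.
Proof. by apply: ge_inf; case: (chain_weights_has_inf S x). Qed.

Lemma chain_dist_ge0 S x : 0 <= chain_dist S x.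
Proof.
apply: lb_le_inf; first by case: (chain_weights_has_inf S x).
by move=> _ [->|[s _ [l _ ->]]]; [exact: ler01|exact: weight_ge0].
Qed.

Lemma chain_dist_le1 S x : chain_dist S x <= 1.
Proof. by apply: chain_dist_le; left. Qed.

Lemma chain_dist_in S x : S x -> chain_dist S x = 0.
Proof.
move=> Sx; apply/eqP; rewrite eq_le chain_dist_ge0 andbT; apply: chain_dist_le.
by right; exists x => //; exists [::]; [rewrite mulgV|rewrite /weight big_nil].
Qed.

Lemma chain_dist_far S x : (forall s, S s -> ~ W 0%N (x / s)%g) -> chain_dist S x = 1.
Proof.
move=> far; apply/eqP; rewrite eq_le chain_dist_le1 /=.
apply: lb_le_inf; first by case: (chain_weights_has_inf S x).
move=> _ [->//|[s Ss [l lx ->]]]; rewrite leNgt; apply/negP => l1.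
by apply: (far s Ss); apply: light_chain lx; rewrite expr0 invr1.
Qed.

(** Prepending the step u to a chain from S to x gives a chain from S to u x. *)
Lemma chain_dist_mul S n u x : W n u -> chain_dist S (u * x)%g <= chain_dist S x + 2 ^- n.
Proof.
move=> Wu; rewrite -lerBlDr; apply: lb_le_inf; first by case: (chain_weights_has_inf S x).
move=> _ [->|[s Ss [l lx ->]]]; rewrite lerBlDr.
  by apply: le_trans (chain_dist_le1 _ _) _; rewrite lerDl invr_ge0 exprn_ge0.
rewrite addrC -weight_cons; apply: chain_dist_le; right; exists s => //.
by exists (n :: l) => //; exists u => //; exists (x / s)%g => //; rewrite mulgA.
Qed.

Lemma chain_dist_RUC S : RUC R G (chain_dist S).
Proof.
have unif (eps : R) : 0 < eps -> exists2 U : set G, nbhs 1%g U &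
    forall g h : G, U (g / h)%g -> `|chain_dist S g - chain_dist S h| < eps.
  move=> e0; have [n _ /(_ n (leqnn n)) /= ne] := near_infty_natSinv_expn_lt (PosNum e0).
  exists (W n) => // g h Wgh; apply: le_lt_trans ne; rewrite div1r ler_distl.
  rewrite lerBlDr; apply/andP; split.
    have := chain_dist_mul S n (g / h)^-1%g g (WV _ _ Wgh).
    by rewrite invgM invgK mulgVK.
  by have := chain_dist_mul S n _ h Wgh; rewrite mulgVK.
split=> //; last exact: right_uniform_continuous.
apply: (@bounded_fun_le _ _ _ 1) => x.
by rewrite ger0_norm ?chain_dist_ge0 ?chain_dist_le1.
Qed.

End Chains.

(** A uniform Urysohn lemma in which V depends on U only and not on S: V is the
    first term of a chain of symmetric neighborhoods, each containing the cube
    of the next. *)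
Lemma RUC_separation (R : realType) {G : topologicalGroupType} (U : set G) :
  nbhs 1%g U -> exists V : set G, [/\ nbhs 1%g V, forall x, V x -> V x^-1%g,
    forall x y, V x -> V y -> U (x^-1 * y)%g &
    forall S : set G, exists f : G -> R, [/\ RUC R G f, forall x, `|f x| <= 1,
      forall x, S x -> f x = 0 &
      forall x, (forall s, S s -> ~ V (x / s)%g) -> f x = 1]].
Proof.
move=> U1.
have /choice[c cP] (A : set G) : exists V : set G, nbhs 1%g A ->
    [/\ nbhs 1%g V, forall x, V x -> V x^-1%g
      & forall x y z, V x -> V y -> V z -> A (x * y * z)%g].
  by have [/sub_cube_nbhs[V VP]|?] := pselect (nbhs (1%g : G) A); [exists V|exists A].
pose W n := iter n.+1 c U.
have W1 n : nbhs 1%g (W n) by elim: n => [|n IH]; [case: (cP _ U1)|case: (cP _ IH)].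
have WV n x : W n x -> W n x^-1%g.
  by case: n => [|n]; [case: (cP _ U1) => _ + _; exact|case: (cP _ (W1 n)) => _ + _; exact].
have W3 n x y z : W n.+1 x -> W n.+1 y -> W n.+1 z -> W n (x * y * z)%g.
  by case: (cP _ (W1 n)) => _ _; exact.
exists (W 0%N); split=> // [x|x y Wx Wy|S]; first exact: WV.
- case: (cP _ U1) => _ _ W0U; rewrite -[(_ * _)%g]mulg1; apply: W0U => //.
    exact: (WV 0%N).
  exact: nbhs_singleton (W1 0%N).
- exists (chain_dist W S); split=> [|x|x|x].
  + exact: chain_dist_RUC.
  + by rewrite ger0_norm ?chain_dist_ge0 ?chain_dist_le1.
  + exact: chain_dist_in.
  + exact: chain_dist_far.
Qed.

(** * Supremum norms and sequences equivalent to the basis of l1 *)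

Lemma supnorm_ge {R : realType} {T : Type} (f : T -> R) (M : R) (x : T) :
  (forall y, `|f y| <= M) -> `|f x| <= supnorm f.
Proof.
by move=> fM; apply: ub_le_sup; [exists M => _ [y _ <-]|exists x].
Qed.

Lemma supnorm_le {R : realType} {T : Type} (f : T -> R) (M : R) (x : T) :
  (forall y, `|f y| <= M) -> supnorm f <= M.
Proof.
by move=> fM; apply: ge_sup; [exists `|f x|; exists x|move=> _ [y _ <-]].
Qed.

(** Evaluating the combination with coefficients c at the pattern of the
    nonnegative c_k and at the pattern of the negative ones gives the sum of
    the positive parts and minus the sum of the negative parts. Both are bounded
    in absolute value by the supremum norm, and they differ by the l1-norm of c;
    this is why the lower constant is 1/2. *)
Lemma independent_l1_sequence {R : realType} {T : Type} (u : nat -> T -> R) :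
  (forall n x, `|u n x| <= 1) ->
  (forall s : seq bool, exists x, forall k, (k < size s)%N -> u k x = (nth false s k)%:R) ->
  l1_sequence u.
Proof.
move=> u1 indep; split=> [n|].
  exact: bounded_fun_le (u1 n).
exists 2^-1, 1; split=> // n c.
have bnd x : `|\sum_(k < n) c k * u k x| <= \sum_(k < n) `|c k|.
  apply: le_trans (ler_norm_sum _ _ _) _; apply: ler_sum => k _.
  by rewrite normrM ler_piMr.
have [x0 _] := indep [::].
rewrite mul1r; apply/andP; split; last exact: supnorm_le.
have pattern (b : 'I_n -> bool) : `|\sum_(k < n) c k * (b k)%:R|
    <= supnorm (fun x => \sum_(k < n) c k * u k x).
  have [x xP] := indep [seq b k | k <- enum 'I_n].
  suff -> : \sum_(k < n) c k * (b k)%:R = \sum_(k < n) c k * u k x by exact: supnorm_ge.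
  apply: eq_bigr => k _; rewrite xP 1?size_map ?size_enum_ord//.
  by rewrite (nth_map k) ?size_enum_ord// nth_ord_enum.
rewrite ler_pdivrMl// mulr_natl mulr2n.
apply: le_trans (lerD (pattern (fun k => 0 <= c k)) (pattern (fun k => c k < 0))).
apply: le_trans (ler_normB _ _); apply: le_trans (ler_norm _).
rewrite -sumrB; apply: ler_sum => k _; have [c0|c0] := leP 0 (c k).
  by rewrite mulr1 mulr0 subr0 ger0_norm.
by rewrite mulr1 mulr0 sub0r ltr0_norm.
Qed.

(** * Precompact groups are tame *)

Lemma precompact_tame (R : realType) (G : topologicalGroupType) :
  precompact_group G -> tame_group R G.
Proof.
move=> pG f [_ _ fu] [u [orb [_ [a [b [a0 b0 ub]]]]]].
have /fu[U U1 Uf] : 0 < a / 2 by rewrite divr_gt0.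
have [|F Ffin GF] := pG U° (@open_interior _ U); first exact: nbhs_singleton (nbhs_interior U1).
have /choice[g gP] n : exists g : G, u n = RUC_act f g.
  by have [g _ <-] := orb n; exists g.
have /choice[y yP] n : exists y : G, F y /\ U (g n / y)%g.
  have : [set: G] (g n) by []; rewrite GF => -[v Uv [x Fx <-]].
  by exists x; split=> //; rewrite mulgK; exact: interior_subset Uv.
have [i [j [ij yij]]] : exists i j, i != j /\ y i = y j.
  apply: contrapT => inj; apply: infinite_nat.
  suff <- : y @^-1` F = [set: nat].
    apply: finite_preimage Ffin => i j _ _ yij.
    by apply: contrapT => /eqP ij; apply: inj; exists i, j.
  by apply/seteqP; split=> // n _; case: (yP n).
have uij x : `|u i x - u j x| <= a.
  have d n : `|u n x - f (y n * x)%g| < a / 2.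
    rewrite gP; apply: Uf; rewrite invgM mulgA mulgK; exact: (yP n).2.
  rewrite [a]splitr; apply: le_trans (ler_distD (f (y i * x)%g) _ _) _.
  by apply: lerD; [exact/ltW/d|rewrite yij distrC; exact/ltW/d].
(* The l1 bound is violated by the difference of the two close terms, written
   as a combination of the first n terms of the sequence. *)
pose n := (maxn i j).+1.
have iln : (i < n)%N by rewrite ltnS leq_maxl.
have jln : (j < n)%N by rewrite ltnS leq_maxr.
pose i' := Ordinal iln; pose j' := Ordinal jln.
have ij' : i' != j' by [].
have ji' : j' != i' by rewrite eq_sym.
have [+ _] := andP (ub n (fun k => (k == i')%:R - (k == j')%:R)).
have e x : \sum_(k < n) ((k == i')%:R - (k == j')%:R) * u k x = u i x - u j x.
  rewrite (bigD1 i')//= (bigD1 j')//=.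
  rewrite big1 ?addr0 => [|k /andP[/negbTE -> /negbTE ->]]; last by rewrite subrr mul0r.
  by rewrite !eqxx (negbTE ij') (negbTE ji') subr0 sub0r mul1r mulN1r.
have -> : \sum_(k < n) `|(k == i')%:R - (k == j')%:R| = 2 :> R.
  rewrite (bigD1 i')//= (bigD1 j')//=.
  rewrite big1 ?addr0 => [|k /andP[/negbTE -> /negbTE ->]]; last by rewrite subrr normr0.
  by rewrite !eqxx (negbTE ij') (negbTE ji') subr0 sub0r normrN normr1.
apply/negP; rewrite -ltNge; apply: (@le_lt_trans _ _ a); last by rewrite ltr_pMr ?ltr1n.
by apply: (supnorm_le _ _ 1%g) => x; rewrite e.
Qed.

(** * Groups that are not precompact have independent orbits *)

(** The points are chosen one at a time: at each stage, the separation from the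
    points chosen before forbids only finitely many sets a V b. Patterns are
    enumerated by [pickle], so that only finitely many come before a given one.
    Points g_m h_s and g_n h_s with the same pattern s are separated because
    (g_m h_s) (g_n h_s)^-1 = g_m g_n^-1. *)
Lemma scattered_sequences {G : topologicalGroupType} (V : set G) :
  (forall x, V x -> V x^-1%g) ->
  (forall s : seq (G * G), exists x, forall p, p \in s -> ~ V (p.1 * x * p.2)%g) ->
  exists (g : nat -> G) (h : seq bool -> G),
    (forall m n, m != n -> ~ V (g m / g n)%g) /\
    (forall s t m n, s != t -> (m < size s)%N -> (n < size t)%N ->
      ~ V ((g m * h s) / (g n * h t))%g).
Proof.
move=> VV escape.
have next (l : seq G) : exists x, forall y, y \in l -> ~ V (x / y)%g.
  have [x xP] := escape [seq (1, y^-1)%g | y <- l].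
  by exists x => y yl; have := xP _ (map_f _ yl); rewrite /= mul1g.
have [g gP] := dependent_sequence _ next.
have gfar m n : m != n -> ~ V (g m / g n)%g.
  wlog nm : m n / (n < m)%N => [IH|_].
    rewrite neq_ltn => /orP[mn|nm] Vmn; last by apply: (IH m n) => //; rewrite neq_ltn nm orbT.
    apply: (IH n m) => //; first by rewrite neq_ltn mn orbT.
    by move: (VV _ Vmn); rewrite invgM invgK.
  by apply: gP; apply: map_f; rewrite mem_iota.
(* The p-th term of the sequence below belongs to the pattern with code p; it is
   multiplied only by the g_m with m less than the size of that pattern. *)
pose width p := size (odflt [::] (unpickle p : option (seq bool))).
have [l|h hP] := dependent_sequence (fun l x => forall q m n, (q < size l)%N ->
  (m < width (size l))%N -> (n < width q)%N -> ~ V ((g m * x) / (g n * nth 1%g l q))%g).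
  have [x xP] := escape [seq (g m, (g qn.2 * nth 1 l qn.1)^-1)%g | m <- iota 0 (width (size l)),
    qn <- [seq (q, n) | q <- iota 0 (size l), n <- iota 0 (width q)]].
  exists x => q m n ql mw nw.
  apply: (xP (g m, (g n * nth 1 l q)^-1)%g).
  apply/allpairsP; exists (m, (q, n)); split=> //=; first by rewrite mem_iota.
  by apply/allpairsPdep; exists q, n; rewrite !mem_iota.
exists g, (h \o pickle); split=> // s t m n st ms nt /=.
have far p q a b : (q < p)%N -> (a < width p)%N -> (b < width q)%N ->
    ~ V ((g a * h p) / (g b * h q))%g.
  by move=> qp ap bq; have := hP p q a b; rewrite size_mkseq nth_mkseq//; exact.
have widthK (w : seq bool) : width (pickle w) = size w by rewrite /width pickleK.
have : pickle s != pickle t by rewrite (inj_eq (pcan_inj pickleK)).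
rewrite neq_ltn => /orP[lt|lt]; last by apply: far; rewrite ?widthK.
by move=> /VV; rewrite invgM invgK; apply: far; rewrite ?widthK.
Qed.

Lemma tame_precompact (R : realType) (G : topologicalGroupType) :
  tame_group R G -> precompact_group G.
Proof.
move=> tG U Uo U1; apply: contrapT => Ubig.
have [|V [V1 VV VU sep]] := @RUC_separation R G U; first exact: open_nbhs_nbhs.
have [g [h [gfar hfar]]] := scattered_sequences V VV (two_sided_escape U V Ubig VU).
have [f [fRUC f1 fS fnS]] := sep [set x | exists n s,
  [/\ (n < size s)%N, ~~ nth false s n & x = (g n * h s)%g]].
apply: (tG f fRUC); exists (fun n => RUC_act f (g n)); split=> [n|]; first by exists (g n).
apply: independent_l1_sequence => [n x|s]; first exact: f1.
exists (h s) => k ks; rewrite /RUC_act.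
have [sk|sk] := boolP (nth false s k); last by apply: fS; exists k, s.
apply: fnS => _ [n [t [nt tn ->]]].
have [st|st] := eqVneq s t; last exact: hfar.
rewrite invgM -st mulgA mulgK; apply: gfar.
by apply: contraNneq tn => <-; rewrite -st.
Qed.

Theorem theorem8 (R : realType) (G : topologicalGroupType)
    (hausdorffG : hausdorff_space G) :
  tame_group R G <-> precompact_group G.
Proof. by split; [exact: tame_precompact|exact: precompact_tame]. Qed.
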